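(* Let $k$ be an infinite field, $n\ge1$ an integer, $q=(q_{ij})$ a multiplicatively antisymmetric $n\times n$ matrix over $k^\times$, $R=k_q[[x_1,\ldots,x_n]]$ the $q$-commutative power series ring, and let the torus $H=(k^\times)^n$ act on $R$ by $h.x^s=h_1^{s_1}\cdots h_n^{s_n}x^s$. For each subset $w$ of $\{1,\ldots,n\}$ let $J_w=\langle x_i\mid i\in w\rangle$ be the ideal of $R$ generated by the $x_i$ with $i\in w$. Then $\{J_w\mid w\subseteq\{1,\ldots,n\}\}$ is the set of $H$-prime ideals of $R$.
   Context: Multiplicatively antisymmetric means $q_{ii}=1$ and $q_{ij}=q_{ji}^{-1}\in k^\times$ for all $i,j$. The ring $R=k_q[[x_1,\ldots,x_n]]$ is the associative unital $k$-algebra of formal skew power series $\sum_{s\in\mathbb{N}^n} c_s x^s$ ($c_s\in k$, $x^s=x_1^{s_1}\cdots x_n^{s_n}$, $\mathbb{N}$ the non-negative integers), with multiplication determined by $x_ix_j=q_{ij}x_jx_i$. The action of $h=(h_1,\ldots,h_n)\in H$ on monomials extends linearly and continuously (coefficientwise) to $k$-algebra automorphisms of $R$. An $H$-ideal is a two-sided ideal stable under $H$. An $H$-ideal $I\neq R$ is $H$-prime if whenever the product of two $H$-ideals of $R$ is contained in $I$, one of these $H$-ideals is contained in $I$. *)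

(* Defs.v *)
From HB Require Import structures.
From mathcomp Require Import all_boot all_order all_algebra.
From mathcomp Require Import ring.
From mathcomp Require Import boolp classical_sets cardinality.
From mathcomp Require Import ssrcomplements freeg mpoly.

Set Implicit Arguments.
Unset Strict Implicit.
Unset Printing Implicit Defensive.

Import GRing.Theory.

Local Open Scope ring_scope.
Local Open Scope classical_set_scope.

Definition mult_antisymmetric (k : fieldType) (n : nat) (q : 'M[k]_n) : Prop :=
  (forall i, q i i = 1) /\
  (forall i j, q i j != 0 /\ q i j = (q j i)^-1).

(* [QSeries f] is the formal series \sum_s f(s) x^s, with ordered monomials
   x^s = x_0^(s_0) ... x_(n-1)^(s_(n-1)).  The matrix q does not occur in the
   carrier; it indexes the type because the product depends on it. *)
Record qpseries (k : fieldType) (n : nat) (q : 'M[k]_n) :=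
  QSeries { qcoef : 'X_{1..n} -> k }.
Arguments QSeries {k n q} qcoef.
Arguments qcoef {k n q} _ _.

Section QPowerSeries.
Context (k : fieldType) (n : nat) (q : 'M[k]_n).
Implicit Types (s u v w : 'X_{1..n}) (i j : 'I_n) (c : k).

Local Notation qseries := (qpseries q).

HB.instance Definition _ := gen_eqMixin qseries.
HB.instance Definition _ := gen_choiceMixin qseries.

Implicit Types (f g : qseries).

Lemma qseriesP f g : qcoef f =1 qcoef g -> f = g.
Proof. by case: f g => f [g] /= /funext ->. Qed.

Definition qzero : qseries := QSeries (fun=> 0).
Definition qopp f : qseries := QSeries (fun s => - qcoef f s).
Definition qadd f g : qseries := QSeries (fun s => qcoef f s + qcoef g s).
Definition qscale c f : qseries := QSeries (fun s => c * qcoef f s).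

Lemma qaddA : associative qadd.
Proof. by move=> f g h; apply: qseriesP => s /=; rewrite addrA. Qed.

Lemma qaddC : commutative qadd.
Proof. by move=> f g; apply: qseriesP => s /=; rewrite addrC. Qed.

Lemma qadd0 : left_id qzero qadd.
Proof. by move=> f; apply: qseriesP => s /=; rewrite add0r. Qed.

Lemma qaddN : left_inverse qzero qopp qadd.
Proof. by move=> f; apply: qseriesP => s /=; rewrite addNr. Qed.

HB.instance Definition _ :=
  GRing.isZmodule.Build qseries qaddA qaddC qadd0 qaddN.

Lemma qscaleA (a b : k) f : qscale a (qscale b f) = qscale (a * b) f.
Proof. by apply: qseriesP => s /=; rewrite mulrA. Qed.

Lemma qscale1 : left_id 1 qscale.
Proof. by move=> f; apply: qseriesP => s /=; rewrite mul1r. Qed.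

Lemma qscaleDr : right_distributive qscale +%R.
Proof. by move=> c f g; apply: qseriesP => s /=; rewrite mulrDr. Qed.

Lemma qscaleDl f : {morph qscale^~ f : a b / a + b}.
Proof. by move=> a b; apply: qseriesP => s /=; rewrite mulrDl. Qed.

HB.instance Definition _ :=
  GRing.Zmodule_isLmodule.Build k qseries qscaleA qscale1 qscaleDr qscaleDl.

(* The scalar such that x^u * x^v = qfactor u v *: x^(u + v): each x_j of x^v
   is moved to the left of each x_i of x^u with j < i, by means of
   x_i * x_j = q i j *: (x_j * x_i). *)
Definition qfactor u v : k :=
  \prod_(i < n) \prod_(j < n | (j < i)%N) q i j ^+ (u i * v j).

Definition qmul f g : qseries := QSeries (fun s =>
  \sum_(u : 'X_{1..n < (mdeg s).+1} | (u <= s)%MM)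
     qfactor u (s - u)%MM * (qcoef f u * qcoef g (s - u)%MM)).

Definition qmon s : qseries := QSeries (fun u => (u == s)%:R).
Definition qvar i : qseries := qmon U_(i)%MM.
Definition qone : qseries := qmon 0%MM.

Lemma qfactorDl u v w : qfactor (u + v)%MM w = qfactor u w * qfactor v w.
Proof.
rewrite /qfactor -big_split /=; apply: eq_bigr => i _.
rewrite -big_split /=; apply: eq_bigr => j _.
by rewrite mnmDE mulnDl exprD.
Qed.

Lemma qfactorDr u v w : qfactor u (v + w)%MM = qfactor u v * qfactor u w.
Proof.
rewrite /qfactor -big_split /=; apply: eq_bigr => i _.
rewrite -big_split /=; apply: eq_bigr => j _.
by rewrite mnmDE mulnDr exprD.
Qed.

Lemma qfactor0l u : qfactor 0%MM u = 1.
Proof.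
by rewrite /qfactor big1 // => i _; rewrite big1 // => j _; rewrite mnm0E mul0n.
Qed.

Lemma qfactor0r u : qfactor u 0%MM = 1.
Proof.
by rewrite /qfactor big1 // => i _; rewrite big1 // => j _; rewrite mnm0E muln0.
Qed.

Lemma qcoef_mul b f g s : (mdeg s < b)%N ->
  qcoef (qmul f g) s =
  \sum_(u : 'X_{1..n < b} | (u <= s)%MM)
     qfactor u (s - u)%MM * (qcoef f u * qcoef g (s - u)%MM).
Proof.
move=> lt_sb /=.
pose Ik : subFinType _ := 'X_{1..n < (mdeg s).+1}.
pose Ib : subFinType _ := 'X_{1..n < b}.
pose P (u : 'X_{1..n}) := (u <= s)%MM.
pose F (u : 'X_{1..n}) := qfactor u (s - u)%MM * (qcoef f u * qcoef g (s - u)%MM).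
rewrite (big_sub_widen Ik Ib P F) /=; last by move=> x /leq_trans; apply.
apply: eq_bigl => u; rewrite /P andb_idr // => /mnm_lepP le_us.
by rewrite ltnS !mdegE leq_sum.
Qed.

Lemma qcoef_mul_rev b f g s : (mdeg s < b)%N ->
  qcoef (qmul f g) s =
  \sum_(u : 'X_{1..n < b} | (u <= s)%MM)
     qfactor (s - u)%MM u * (qcoef f (s - u)%MM * qcoef g u).
Proof.
move=> lt_sb; rewrite (qcoef_mul _ _ lt_sb).
have pr u : (mdeg (s - u)%MM < b)%N by exact: leq_ltn_trans (mdegB _ _) _.
pose F (u : 'X_{1..n < b}) := BMultinom (pr u).
have invF u : (u <= s)%MM -> (s - (s - u))%MM = u.
  by move=> le_us; rewrite submBA // addmC addmK.
rewrite (reindex_onto F F) /=; last first.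
  by move=> u /invF equ; apply/eqP; rewrite eqE /= equ.
apply/esym/eq_big => [u /=|u /invF -> //]; apply/esym; rewrite lem_subr eqE /=.
by apply/eqP/idP => [<-|/invF //]; apply/mnm_lepP=> i; rewrite !mnmBE leq_subr.
Qed.

Lemma qmulA : associative qmul.
Proof.
move=> p r t; apply: qseriesP => s; pose b := (mdeg s).+1.
have lt_sb : (mdeg s < b)%N by [].
rewrite (qcoef_mul _ _ lt_sb) (qcoef_mul_rev _ _ lt_sb).
have lt_b u : (mdeg (s - u)%MM < b)%N by exact/(leq_ltn_trans (mdegB s u)).
pose X u v := qfactor u (s - u)%MM * (qcoef p u *
  (qfactor (s - u - v)%MM v * (qcoef r (s - u - v)%MM * qcoef t v))).
transitivity (\sum_(u : 'X_{1..n < b} | (u <= s)%MM)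
                \sum_(v : 'X_{1..n < b} | (v <= s - u)%MM) X u v).
  by apply: eq_bigr => u _; rewrite (qcoef_mul_rev _ _ (lt_b u)) !big_distrr.
rewrite (exchange_big_dep (fun v : 'X_{1..n < b} => (v <= s)%MM)); last first.
  by move=> u v _ /= /lepm_trans; apply; apply/lem_subr.
apply: eq_bigr => v /mnm_lepP le_vs.
rewrite (qcoef_mul _ _ (lt_b v)) big_distrl big_distrr /=.
apply: eq_big => [u|u /andP[/mnm_lepP le_us /mnm_lepP le_vsu]].
  apply/andP/mnm_lepP => [[/mnm_lepP le1 /mnm_lepP le2] i|le1].
    have := le2 i; have := le1 i; rewrite !mnmBE => le1i le2i.
    by rewrite leq_subRL // addnC -leq_subRL.
  have le_us i : (u i <= s i)%N.
    by apply: leq_trans (le1 i) _; rewrite mnmBE leq_subr.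
  split; apply/mnm_lepP => // i; have := le1 i.
  by rewrite !mnmBE !leq_subRL // addnC.
have eqs : (s - v - u = s - u - v)%MM by rewrite !submDA addmC.
have eq1 : (s - u = (s - u - v) + v)%MM by rewrite submK //; apply/mnm_lepP.
have eq2 : (s - v = u + (s - u - v))%MM.
  rewrite -eqs addmC submK //; apply/mnm_lepP => i; have := le_vsu i.
  by rewrite !mnmBE !leq_subRL // addnC.
rewrite /X eqs {1}eq1 [in qfactor (s - v) v]eq2 qfactorDr qfactorDl; ring.
Qed.

Lemma qmul1 : left_id qone qmul.
Proof.
move=> f; apply: qseriesP => s /=.
rewrite (bigD1 (bm0 : 'X_{1..n < (mdeg s).+1})) /=; last by apply/mnm_lepP => i; rewrite mnm0E.
rewrite subm0 qfactor0l eqxx !mul1r big1 ?addr0 // => u /andP[_ neq_u0].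
by rewrite -(inj_eq val_inj) /= in neq_u0; rewrite (negbTE neq_u0) mul0r mulr0.
Qed.

Lemma qmulr1 : right_id qone qmul.
Proof.
move=> f; apply: qseriesP => s; rewrite (qcoef_mul_rev _ _ (ltnSn _)).
rewrite (bigD1 (bm0 : 'X_{1..n < (mdeg s).+1})) /=; last by apply/mnm_lepP => i; rewrite mnm0E.
rewrite subm0 qfactor0r eqxx mul1r mulr1 big1 ?addr0 // => u /andP[_ neq_u0].
by rewrite -(inj_eq val_inj) /= in neq_u0; rewrite (negbTE neq_u0) !mulr0.
Qed.

Lemma qmulDl : left_distributive qmul +%R.
Proof.
move=> f g h; apply: qseriesP => s /=; rewrite -big_split /=.
by apply: eq_bigr => u _; rewrite mulrDl mulrDr.
Qed.

Lemma qmulDr : right_distributive qmul +%R.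
Proof.
move=> f g h; apply: qseriesP => s /=; rewrite -big_split /=.
by apply: eq_bigr => u _; rewrite !mulrDr.
Qed.

Lemma qone_neq0 : qone != 0.
Proof.
by apply/eqP => /(congr1 (qcoef^~ 0%MM)) /eqP; rewrite /= eqxx oner_eq0.
Qed.

HB.instance Definition _ := GRing.Zmodule_isNzRing.Build qseries
  qmulA qmul1 qmulr1 qmulDl qmulDr qone_neq0.

Lemma qscaleAl c f g : c *: (f * g) = c *: f * g.
Proof.
apply: qseriesP => s /=; rewrite big_distrr /=.
by apply: eq_bigr => u _; rewrite mulrCA !mulrA.
Qed.

HB.instance Definition _ := GRing.Lmodule_isLalgebra.Build k qseries qscaleAl.

Lemma qscaleAr c f g : c *: (f * g) = f * (c *: g).
Proof.
apply: qseriesP => s /=; rewrite big_distrr /=.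
by apply: eq_bigr => u _; rewrite mulrCA; congr (_ * _); rewrite mulrCA.
Qed.

HB.instance Definition _ := GRing.Lalgebra_isAlgebra.Build k qseries qscaleAr.

Lemma qmonM u v : qmon u * qmon v = qfactor u v *: qmon (u + v)%MM.
Proof.
apply: qseriesP => s /=; have [->|neq_s] := eqVneq s (u + v)%MM; last first.
  rewrite mulr0 big1 // => w /submK sw; case: eqP => [ewu|]; last first.
    by rewrite mul0r mulr0.
  case: eqP => [ewv|]; last by rewrite !mulr0.
  by case/eqP: neq_s; rewrite -sw ewu addmC -ewv ewu.
have lt_u : (mdeg u < (mdeg (u + v)%MM).+1)%N by rewrite mdegD ltnS leq_addr.
rewrite (bigD1 (BMultinom lt_u)) /=; last exact: lem_addr.
have -> : (u + v - u = v)%MM by rewrite addmC addmK.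
rewrite !eqxx !mulr1 big1 ?addr0 // => w /andP[_].
by rewrite -(inj_eq val_inj) /= => /negbTE ->; rewrite mul0r mulr0.
Qed.

Lemma qvarC i j : mult_antisymmetric q ->
  qvar i * qvar j = q i j *: (qvar j * qvar i).
Proof.
have facE (a b : 'I_n) :
    qfactor U_(a)%MM U_(b)%MM = if (b < a)%N then q a b else 1.
  rewrite /qfactor (bigD1 a) //= [X in _ * X]big1 ?mulr1; last first.
    move=> c ne_ca; rewrite big1 // => d _.
    by rewrite mnm1E eq_sym (negbTE ne_ca).
  case: ifP => lt_ba; last first.
    rewrite big1 // => d lt_da; rewrite [U_(b)%MM d]mnm1E.
    by have [eqbd|_] := eqVneq b d; rewrite ?muln0 //; rewrite eqbd lt_da in lt_ba.
  rewrite (bigD1 b) //= !mnm1E !eqxx expr1 big1 ?mulr1 // => d /andP[_ ne_db].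
  by rewrite !mnm1E [b == d]eq_sym (negbTE ne_db) muln0.
case=> qii qij; rewrite /qvar !qmonM !facE [(U_(j) + _)%MM]addmC scalerA.
case: (ltngtP j i) => [lt_ji|lt_ij|/val_inj->]; rewrite ?qii ?mulr1 //.
by have [nz0 ->] := qij i j; rewrite mulVf //; case: (qij j i).
Qed.

Lemma qfactor_disjoint u v :
  (forall i j, (j < i)%N -> (u i * v j = 0)%N) -> qfactor u v = 1.
Proof.
move=> uv0; rewrite /qfactor big1 // => i _; rewrite big1 // => j lt_ji.
by rewrite uv0.
Qed.

Lemma qvarX i m : qvar i ^+ m = qmon (U_(i) *+ m)%MM.
Proof.
elim: m => [|m IHm]; first by rewrite expr0 mulm0n.
rewrite exprS IHm qmonM mulmS qfactor_disjoint ?scale1r // => a b lt_ba.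
rewrite mulmnE !mnm1E; case: eqP => [->|//]; case: eqP => [eqba|]; last by [].
by rewrite eqba ltnn in lt_ba.
Qed.

Lemma qmonE s : qmon s = \prod_(i < n) qvar i ^+ s i.
Proof.
rewrite {1}[s]multinomUE_id.
have -> : index_enum 'I_n = enum 'I_n by rewrite [index_enum _]unlock -enumT.
have : sorted ltn (map val (enum 'I_n)) by rewrite val_enum_ord iota_ltn_sorted.
elim: (enum 'I_n) => [|i r IHr] srt; first by rewrite !big_nil.
rewrite !big_cons -(IHr (path_sorted srt)) qvarX qmonM.
rewrite qfactor_disjoint ?scale1r // => a b lt_ba.
rewrite mulmnE mnm1E; case: eqP => [eq_ia|]; last by rewrite !mul0n.
rewrite mnm_sumE big_seq big1 ?muln0 // => c c_r.
rewrite mulmnE mnm1E; case: eqP => [eq_cb|]; last by rewrite mul0n.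
have := order_path_min ltn_trans srt; move/allP/(_ _ (map_f val c_r)) => /=.
by rewrite eq_cb eq_ia ltnNge (ltnW lt_ba).
Qed.

(* The action of h on x^s multiplies it by h_0^(s_0) ... h_(n-1)^(s_(n-1)),
   extended to series coefficientwise. *)
Definition hact (h : 'rV[k]_n) f : qseries :=
  QSeries (fun s => (\prod_(i < n) h 0 i ^+ s i) * qcoef f s).

Lemma hactD h : {morph hact h : f g / f + g}.
Proof. by move=> f g; apply: qseriesP => s /=; rewrite mulrDr. Qed.

Lemma hactZ h c : {morph hact h : f / c *: f}.
Proof. by move=> f; apply: qseriesP => s /=; rewrite mulrCA. Qed.

Lemma hact1 h : hact h 1 = 1.
Proof.
apply: qseriesP => s /=; case: eqP => [->|_]; last by rewrite mulr0.
by rewrite mulr1 big1 // => i _; rewrite mnm0E.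
Qed.

Lemma hactM h : {morph hact h : f g / f * g}.
Proof.
move=> f g; apply: qseriesP => s /=; rewrite big_distrr /=.
apply: eq_bigr => u /submK eq_s; rewrite mulrCA; congr (_ * _).
rewrite mulrACA; congr (_ * _); rewrite -big_split /=; apply: eq_bigr => i _.
by rewrite -exprD -[in LHS]eq_s mnmDE addnC.
Qed.

Definition torus : set 'rV[k]_n := [set h | forall i, h 0 i != 0].

Definition Hstable (I : set qseries) : Prop :=
  forall h, torus h -> forall f, I f -> I (hact h f).

End QPowerSeries.

Section Ideals.
Context (R : nzRingType).

Definition two_sided_ideal (I : set R) : Prop :=
  [/\ I 0,
      forall x y, I x -> I y -> I (x + y),
      forall a x, I x -> I (a * x) &
      forall a x, I x -> I (x * a)].

Definition ideal_gen (S : set R) : set R := smallest two_sided_ideal S.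

Definition ideal_mul (A B : set R) : set R :=
  [set x | exists2 t : seq (R * R),
     (forall p, p \in t -> A p.1 /\ B p.2) & x = \sum_(p <- t) p.1 * p.2].

End Ideals.

Section HPrimes.
Context (k : fieldType) (n : nat) (q : 'M[k]_n).

Definition Hideal (I : set (qpseries q)) : Prop :=
  two_sided_ideal I /\ Hstable I.

Definition Hprime (I : set (qpseries q)) : Prop :=
  [/\ Hideal I, I <> setT &
      forall A B, Hideal A -> Hideal B ->
        ideal_mul A B `<=` I -> A `<=` I \/ B `<=` I].

Definition Jideal (w : {set 'I_n}) : set (qpseries q) :=
  ideal_gen [set qvar q i | i in [set` w]].

End HPrimes.
Arguments Jideal {k n} q w _.

(* Main.v *)
(* Dickson's lemma writes a nonzero f as a finite sum of x^t u_t, where t runs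
   over distinct exponents and each u_t has nonzero constant term, hence is
   invertible.  As k is infinite, some h in H acts on these x^t with distinct
   eigenvalues; this allows the terms to be eliminated one at a time inside an
   H-ideal containing f, so that an H-ideal contains every x^s occurring in one
   of its elements.  Thus H-ideals correspond to upward closed sets of exponents,
   and H-primality forces, and is implied by, such a set being of the form
   { s | s_i > 0 for some i in w }. *)

Require Import Defs.
From HB Require Import structures.
From mathcomp Require Import all_boot all_order all_algebra.
From mathcomp Require Import boolp classical_sets cardinality.
From mathcomp Require Import ssrcomplements freeg mpoly.

Set Implicit Arguments.
Unset Strict Implicit.
Unset Printing Implicit Defensive.

Local Open Scope ring_scope.
Local Open Scope classical_set_scope.

Import GRing.Theory.

(** * Separating monomials *)

Lemma poly_nonroot (R : idomainType) (p : {poly R}) (r : seq R) :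
  p != 0 -> uniq r -> (size p <= size r)%N -> exists2 x, x \in r & p.[x] != 0.
Proof.
move=> p0 ur szr; have /allPn[x xr npx] : ~~ all (root p) r.
  by apply/negP => /(max_poly_roots p0)/(_ ur); rewrite ltnNge szr.
by exists x.
Qed.

(* [e i = b ^ i], where the natural number [b] avoids the zeros of the pairwise
   differences of the polynomials [\sum_i s_i 'X^i]. *)
Lemma separating_weights (n : nat) (F : seq 'X_{1..n}) :
  exists e : 'I_n -> nat, {in F &, forall s t : 'X_{1..n}, s != t ->
    (\sum_(i < n) e i * s i)%N != (\sum_(i < n) e i * t i)%N}.
Proof.
pose P (s : 'X_{1..n}) : {poly int} := \sum_(i < n) (s i)%:R%:P * 'X^i.
have PE (s : 'X_{1..n}) (i : 'I_n) : (P s)`_i = (s i)%:R.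
  rewrite coef_sum (bigD1 i) //= coefCM coefXn eqxx mulr1 big1 ?addr0 // => j ji.
  by rewrite coefCM coefXn eq_sym (negbTE (ji : (j : nat) != i)) mulr0.
have Pinj : injective P.
  move=> s t eqst; apply/mnmP => i; have := PE s i.
  by rewrite eqst PE !pmulrn => /eqP; rewrite eqr_int => /eqP[].
pose D := \prod_(s <- F) \prod_(t <- F | s != t) (P s - P t).
have D0 : D != 0.
  rewrite prodf_seq_neq0; apply/allP => s _ /=; rewrite prodf_seq_neq0.
  by apply/allP => t _; apply/implyP => st; rewrite subr_eq0 (inj_eq Pinj).
have inj_nat : injective (fun m : nat => m%:R : int).
  by move=> a b /eqP; rewrite !pmulrn eqr_int => /eqP[].
have [|||_ /mapP[b _ ->] Db] := @poly_nonroot _ D [seq m%:R | m <- iota 0 (size D)].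
- by [].
- by rewrite map_inj_uniq ?iota_uniq.
- by rewrite size_map size_iota.
exists (fun i => (b ^ i)%N) => s t sF tF st; apply/eqP => eqst.
have PbE u : (P u).[b%:R] = (\sum_(i < n) b ^ i * u i)%N%:R.
  rewrite horner_sum natr_sum; apply: eq_bigr => i _.
  by rewrite hornerCM hornerXn natrM natrX mulrC.
move: Db; rewrite horner_prod prodf_seq_neq0 => /allP/(_ _ sF) /=.
rewrite horner_prod prodf_seq_neq0 => /allP/(_ _ tF); rewrite st /=.
by rewrite hornerD hornerN !PbE eqst subrr eqxx.
Qed.

(** Taking [h_i = y ^ e_i] turns the character of each [x^s] into [y ^ w s], where [w] is injective
    on [F]. Only finitely many [y] are then excluded, and [k] is infinite. *)
Lemma separating_torus (k : fieldType) (n : nat) (F : seq 'X_{1..n}) :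
  infinite_set [set: k] -> exists2 h : 'rV[k]_n, torus h &
    {in F &, forall s t : 'X_{1..n}, s != t ->
      \prod_(i < n) h 0 i ^+ s i != \prod_(i < n) h 0 i ^+ t i}.
Proof.
move=> hk; have [e eP] := separating_weights F.
pose w (s : 'X_{1..n}) := (\sum_(i < n) e i * s i)%N.
(* The factor ['X] keeps [y] nonzero, so that [h] lies in the torus. *)
pose D : {poly k} :=
  'X * \prod_(s <- F) \prod_(t <- F | s != t) ('X^(w s) - 'X^(w t)).
have D0 : D != 0.
  rewrite mulf_neq0 ?polyX_eq0 // prodf_seq_neq0; apply/allP => s sF /=.
  rewrite prodf_seq_neq0; apply/allP => t tF; apply/implyP => st.
  rewrite subr_eq0; apply/eqP => /(congr1 (fun p : {poly k} => p`_(w s)))/eqP.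
  by rewrite !coefXn eqxx (negbTE (eP _ _ sF tF st)) oner_eq0.
have [B _ szB] := infinite_set_fset (size D) hk.
have [y _ Dy] := poly_nonroot D0 (finmap.fset_uniq B) szB.
move: Dy; rewrite hornerM mulf_eq0 negb_or hornerX => /andP[y0 Dy].
have hE (s : 'X_{1..n}) :
    \prod_(i < n) (\row_i y ^+ e i : 'rV[k]_n) 0 i ^+ s i = y ^+ w s.
  by rewrite expr_sum; apply: eq_bigr => i _; rewrite mxE -exprM.
exists (\row_i y ^+ e i) => [i|s t sF tF st]; first by rewrite mxE expf_neq0.
move: Dy; rewrite horner_prod prodf_seq_neq0 => /allP/(_ _ sF) /=.
rewrite horner_prod prodf_seq_neq0 => /allP/(_ _ tF); rewrite st /=.
by rewrite hornerD hornerN !hornerXn subr_eq0 !hE.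
Qed.

(** * Dickson's lemma *)

(** Induction on the number [m] of leading coordinates that are compared; the ambient [n] stays
    fixed. *)
Lemma dickson (n : nat) (S : set 'X_{1..n}) :
  exists2 F : seq 'X_{1..n}, [set` F] `<=` S &
    forall s, S s -> exists2 t, t \in F & (t <= s)%MM.
Proof.
suff /(_ n (leqnn n) S)[F FS FP] : forall m, (m <= n)%N -> forall S : set 'X_{1..n},
    exists2 F : seq 'X_{1..n}, [set` F] `<=` S & forall s, S s ->
      exists2 t, t \in F & forall i : 'I_n, (i < m)%N -> (t i <= s i)%N.
  exists F => // s /FP[t tF ts]; exists t => //; apply/mnm_lepP => i.
  exact: ts (ltn_ord i).
elim=> [_ {}S|m IH mn {}S].
  have [[s Ss]|S0] := pselect (exists s, S s).
    by exists [:: s] => [t /=|t _]; [rewrite inE => /eqP ->|exists s; rewrite ?inE].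
  by exists [::] => // s Ss; case: S0; exists s.
pose im := Ordinal mn.
have [F0 F0S F0P] := IH (ltnW mn) S.
pose T b := [set s | S s /\ s im = b].
have /choice[G GP] b : exists F : seq 'X_{1..n}, [set` F] `<=` T b /\
    forall s, T b s -> exists2 t, t \in F &
      forall i : 'I_n, (i < m)%N -> (t i <= s i)%N.
  by have [F FT FP] := IH (ltnW mn) (T b); exists F.
(* Once [s im] reaches [B], the new coordinate is no constraint for [F0]. Below [B] there are
   finitely many slices [s im = b], each with its own finite set [G b]. *)
pose B := (\max_(t <- F0) t im)%N.
exists (F0 ++ flatten [seq G b | b <- iota 0 B]).
  move=> s /=; rewrite mem_cat => /orP[/F0S //|/flatten_mapP[b _ sG]].
  by have [/(_ _ sG)[]] := GP b.
move=> s Ss; have [Bs|sB] := leqP B (s im).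
  have [t tF0 ts] := F0P _ Ss; exists t; first by rewrite mem_cat tF0.
  move=> i; rewrite ltnS leq_eqVlt => /orP[/eqP ei|/ts //].
  have -> : i = im by exact: val_inj.
  apply: leq_trans Bs.
  exact: (leq_bigmax_seq (F := fun t : 'X_{1..n} => t im)) tF0 isT.
have [GT GP'] := GP (s im); have [t tG ts] := GP' s (conj Ss erefl).
exists t.
  rewrite mem_cat; apply/orP; right; apply/flatten_mapP; exists (s im) => //.
  by rewrite mem_iota.
move=> i; rewrite ltnS leq_eqVlt => /orP[/eqP ei|/ts //].
by have -> : i = im by [exact: val_inj]; have [_ ->] := GT _ tG.
Qed.

(** * Arithmetic of q-commutative power series *)

Section QSeriesTheory.
Context (k : fieldType) (n : nat) (q : 'M[k]_n).
Implicit Types (f g : qpseries q) (s t u v : 'X_{1..n}) (I : set (qpseries q)).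

Lemma qcoefD f g s : qcoef (f + g) s = qcoef f s + qcoef g s.
Proof. by []. Qed.

Lemma qcoefN f s : qcoef (- f) s = - qcoef f s.
Proof. by []. Qed.

Lemma qcoefZ c f s : qcoef (c *: f) s = c * qcoef f s.
Proof. by []. Qed.

Lemma qcoef1 s : qcoef (1 : qpseries q) s = (s == 0%MM)%:R.
Proof. by []. Qed.

Lemma qcoef_sum (T : Type) (r : seq T) (F : T -> qpseries q) s :
  qcoef (\sum_(i <- r) F i) s = \sum_(i <- r) qcoef (F i) s.
Proof.
by elim: r => [|i r IH]; rewrite ?big_nil ?big_cons // qcoefD IH.
Qed.

Lemma qcoefM_neq0 f g s : qcoef (f * g) s != 0 ->
  exists u, [/\ (u <= s)%MM, qcoef f u != 0 & qcoef g (s - u)%MM != 0].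
Proof.
apply: contra_neqP => /forallNP no; apply: big1 => u us.
have [fu|fu] := eqVneq (qcoef f u) 0; first by rewrite fu mul0r mulr0.
have [gu|gu] := eqVneq (qcoef g (s - u)%MM) 0; first by rewrite gu !mulr0.
by case: (no u).
Qed.

Lemma eq_qcoefM f g g' s :
  (forall v, (v <= s)%MM -> qcoef g v = qcoef g' v) ->
  qcoef (f * g) s = qcoef (f * g') s.
Proof.
by move=> eqg; apply: eq_bigr => u us; rewrite eqg // lem_subr.
Qed.

Lemma qcoef_qmonM t g s : qcoef (qmon q t * g) s =
  if (t <= s)%MM then qfactor q t (s - t)%MM * qcoef g (s - t)%MM else 0.
Proof.
case: ifP => [ts|nts].
  have lt_t : (mdeg t < (mdeg s).+1)%N.
    by rewrite ltnS !mdegE leq_sum // => i _; exact/mnm_lepP.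
  rewrite /= (bigD1 (BMultinom lt_t)) //= eqxx mul1r big1 ?addr0 // => u /andP[_].
  by rewrite -(inj_eq val_inj) /= => /negbTE ->; rewrite mul0r mulr0.
rewrite /= big1 // => u us; case: eqP => [ut|]; last by rewrite mul0r mulr0.
by rewrite -ut us in nts.
Qed.

Lemma qcoefM0 f g : qcoef (f * g) 0%MM = qcoef f 0%MM * qcoef g 0%MM.
Proof.
have sub0m u : (0 - u = 0)%MM by apply/mnmP => i; rewrite mnmBE mnm0E.
rewrite /= (bigD1 (bm0 : 'X_{1..n < (mdeg (0%MM : 'X_{1..n})).+1})) /=; last first.
  exact: lepm_refl.
rewrite sub0m qfactor0l mul1r big1 ?addr0 // => u /andP[/mnm_lepP u0].
rewrite -(inj_eq val_inj) /= => /eqP[]; apply/mnmP => i.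
by apply/eqP; have := u0 i; rewrite mnm0E leqn0.
Qed.

Lemma qfactor_neq0 s t : mult_antisymmetric q -> qfactor q s t != 0.
Proof.
case=> _ qij; apply/prodf_neq0 => i _; apply/prodf_neq0 => j _.
by rewrite expf_neq0 //; case: (qij i j).
Qed.

(** Each of the [m] factors contributes a monomial of degree at least 1. *)
Lemma qcoefX_neq0 f m s : qcoef f 0%MM = 0 -> qcoef (f ^+ m) s != 0 ->
  (m <= mdeg s)%N.
Proof.
move=> f0; elim: m s => // m IH s; rewrite exprS => /qcoefM_neq0[u [us fu gu]].
rewrite -(submK us) addmC mdegD -add1n leq_add ?IH // lt0n mdeg_eq0.
by apply: contra_neq fu => ->.
Qed.

(* The inverse of [1 - m] is the series of powers of [m]; in degree [d] only
   the powers up to [d] contribute. *)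
Lemma qseries_rinv f : qcoef f 0%MM != 0 -> exists g, f * g = 1.
Proof.
move=> f0; pose c := qcoef f 0%MM; pose m := 1 - c^-1 *: f.
have m0 : qcoef m 0%MM = 0.
  by rewrite qcoefD qcoefN qcoefZ qcoef1 eqxx mulVf ?subrr.
pose V N := \sum_(i < N) m ^+ i.
have VE N s : (mdeg s < N)%N -> qcoef (V N) s = qcoef (V (mdeg s).+1) s.
  elim: N => // N IH; rewrite ltnS leq_eqVlt => /orP[/eqP -> //|sN].
  rewrite [V N.+1]big_ord_recr qcoefD IH //.
  suff -> : qcoef (m ^+ N) s = 0 by rewrite addr0.
  by apply: contraTeq sN => /(qcoefX_neq0 m0); rewrite -leqNgt.
pose W : qpseries q := QSeries (fun s => qcoef (V (mdeg s).+1) s).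
have fE : f = c *: (1 - m) by rewrite subKr scalerA mulfV ?scale1r.
exists (c^-1 *: W); rewrite fE -scalerAl -scalerAr scalerA mulfV // scale1r.
apply: qseriesP => s.
(* Up to the degree of [s], [W] agrees with a partial geometric sum, whose product with [1 - m]
   telescopes. *)
rewrite (@eq_qcoefM _ _ (V (mdeg s).+1)); last first.
  move=> v vs; rewrite VE // ltnS !mdegE leq_sum // => i _; exact/mnm_lepP.
have -> : (1 - m) * V (mdeg s).+1 = 1 - m ^+ (mdeg s).+1.
  by rewrite -[LHS]opprK -mulNr opprB -subrX1 opprB.
rewrite qcoefD qcoefN.
suff -> : qcoef (m ^+ (mdeg s).+1) s = 0 by rewrite subr0.
by apply: contraFeq (ltnn (mdeg s)) => /(qcoefX_neq0 m0).
Qed.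

Lemma hact_qmon (h : 'rV[k]_n) t :
  hact h (qmon q t) = (\prod_(i < n) h 0 i ^+ t i) *: qmon q t.
Proof.
apply: qseriesP => s; rewrite qcoefZ /=.
by case: eqP => [->|_]; rewrite ?mulr0.
Qed.

Lemma qcoef_hact0 (h : 'rV[k]_n) f : qcoef (hact h f) 0%MM = qcoef f 0%MM.
Proof. by rewrite /= big1 ?mul1r // => i _; rewrite mnm0E expr0. Qed.

(* Each monomial of [f] is attached to the first element of [F] below it; only
   the elements of [F] attached to themselves are kept, so that their
   cofactors start with the corresponding coefficient of [f]. *)
Lemma qseries_decomp f (F : seq 'X_{1..n}) : mult_antisymmetric q ->
  (forall s, qcoef f s != 0 -> exists2 t, t \in F & (t <= s)%MM) ->
  exists F' (g : 'X_{1..n} -> qpseries q),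
    [/\ uniq F', {subset F' <= F}, f = \sum_(t <- F') qmon q t * g t,
        forall t, t \in F' -> qcoef f t != 0 -> qcoef (g t) 0%MM != 0 &
        forall s, qcoef f s != 0 -> exists2 t, t \in F' & (t <= s)%MM].
Proof.
move=> hq cover; pose below s := [pred t | (t <= s)%MM].
pose a s := nth 0%MM F (find (below s) F).
have aP s : has (below s) F -> [/\ a s \in F, (a s <= s)%MM & a (a s) = a s].
  move=> hs; have as_s : (a s <= s)%MM by have := nth_find 0%MM hs.
  split; rewrite ?mem_nth -?has_find //.
  (* The two searches stop at the same index: [a s] lies below itself, and whatever lies below [a s]
     lies below [s]. *)
  rewrite {1}/a; congr nth; apply/eqP; rewrite eqn_leq; apply/andP; split.
    rewrite leqNgt; apply/negP => /(before_find 0%MM).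
    by rewrite /= lepm_refl.
  by apply: sub_find => t /= tas; exact: lepm_trans tas as_s.
pose F' := undup [seq t <- F | a t == t].
have FP s : qcoef f s != 0 -> a s \in F' /\ (a s <= s)%MM.
  move=> /cover[t tF ts]; have [|asF ass aas] := aP s; first by apply/hasP; exists t.
  by rewrite mem_undup mem_filter aas eqxx.
(* The inverse of [qfactor] cancels the scalar produced by [x^t * x^v]. *)
pose g t : qpseries q := QSeries (fun v =>
  if a (t + v)%MM == t then (qfactor q t v)^-1 * qcoef f (t + v)%MM else 0).
exists F', g; split; first exact: undup_uniq.
- by move=> t; rewrite mem_undup mem_filter => /andP[].
- apply: qseriesP => s; rewrite qcoef_sum.
  have gE t : qcoef (qmon q t * g t) s =
      if (t <= s)%MM && (a s == t) then qcoef f s else 0.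
    rewrite qcoef_qmonM; case: ifP => //= ts.
    rewrite addmC submK //; case: ifP; rewrite ?mulr0 // => _.
    by rewrite mulrA mulfV ?mul1r // qfactor_neq0.
  rewrite (eq_bigr _ (fun t _ => gE t)).
  have [fs|/FP[asF ass]] := eqVneq (qcoef f s) 0.
    by rewrite fs big1 // => t _; case: ifP.
  rewrite (bigD1_seq (a s)) ?undup_uniq //= ass eqxx big1 ?addr0 // => t nt.
  by rewrite [a s == t]eq_sym (negbTE nt) andbF.
- move=> t; rewrite mem_undup mem_filter => /andP[/eqP att tF] ft /=.
  by rewrite addm0 att eqxx qfactor0r invr1 mul1r.
- by move=> s /FP[asF ass]; exists (a s).
Qed.

(** * Monomials in H-ideals *)

Lemma two_sided_idealZ I c f : two_sided_ideal I -> I f -> I (c *: f).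
Proof. by case=> _ _ IMl _ If; rewrite -[f]mul1r scalerAl; exact: IMl. Qed.

Lemma two_sided_idealB I f g : two_sided_ideal I -> I f -> I g -> I (f - g).
Proof.
move=> idI If Ig; have [_ ID _ _] := idI; rewrite -scaleN1r.
by apply: ID => //; exact: two_sided_idealZ.
Qed.

(* Call [f] the sum.  Normalising [g r] to [1] on the right, and with [h]
   separating the monomials, [h.f - h^r f] no longer involves [x^r] while its
   other cofactors stay invertible. *)
Lemma Hideal_eliminate I (F : seq 'X_{1..n}) (g : 'X_{1..n} -> qpseries q) t :
  infinite_set [set: k] -> Hideal I -> uniq (t :: F) ->
  {in t :: F, forall s, qcoef (g s) 0%MM != 0} ->
  I (\sum_(s <- t :: F) qmon q s * g s) -> I (qmon q t).
Proof.
move=> hk [idI HI]; have [_ _ _ IMr] := idI.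
elim: F g => [|r F IH] g utF g0 If.
  have [v gv] := qseries_rinv (g0 t (mem_head _ _)).
  have /(IMr v) := If; rewrite big_seq1 -mulrA gv.
  by rewrite mulr1.
have rtF : r \in t :: r :: F by rewrite !inE eqxx orbT.
have [v gv] := qseries_rinv (g0 r rtF).
have v0 : qcoef v 0%MM != 0.
  apply/eqP => v0; have /eqP := congr1 (fun f => qcoef f 0%MM) gv.
  by rewrite qcoefM0 v0 mulr0 qcoef1 eqxx eq_sym oner_eq0.
have [h Th hP] := separating_torus (t :: r :: F) hk.
pose chi s := \prod_(i < n) h 0 i ^+ s i.
(* This is the cofactor of [x^s] in [h.(f v) - chi r (f v)], since [h.x^s = chi s x^s]. Its constant
   term is that of [g s * v] times [chi s - chi r]. *)
pose g' s := chi s *: hact h (g s * v) - chi r *: (g s * v).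
apply: (IH g').
- by move: utF; rewrite /= inE negb_or => /and3P[/andP[_ ->] _ ->].
- move=> s stF; have [sr sF] : s != r /\ s \in t :: r :: F.
    move: stF utF; rewrite !inE /= !negb_or => /orP[/eqP ->|sF].
      by rewrite eqxx => /andP[/andP[-> _] _].
    rewrite sF !orbT => /and3P[_ rF _]; split=> //.
    by apply: contraNneq rF => <-.
  rewrite qcoefD qcoefN !qcoefZ qcoef_hact0 -mulrBl qcoefM0.
  by rewrite !mulf_neq0 ?g0 // subr_eq0 hP.
- have If' := IMr v _ If; set f' := _ * v in If'.
  suff <- : hact h f' - chi r *: f' = \sum_(s <- t :: F) qmon q s * g' s.
    by apply: two_sided_idealB => //; [exact: HI|exact: two_sided_idealZ].
  have hsum (S : seq 'X_{1..n}) (G : 'X_{1..n} -> qpseries q) :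
      hact h (\sum_(s <- S) G s) = \sum_(s <- S) hact h (G s).
    elim: S => [|s S IHS]; last by rewrite !big_cons hactD IHS.
    by rewrite !big_nil; apply: qseriesP => s /=; rewrite mulr0.
  have -> : hact h f' - chi r *: f' = \sum_(s <- t :: r :: F) qmon q s * g' s.
    rewrite /f' mulr_suml hsum scaler_sumr -sumrB; apply: eq_bigr => s _.
    rewrite -mulrA hactM hact_qmon -scalerAl /g' mulrBr.
    by rewrite -!scalerAr.
  rewrite !big_cons; suff -> : g' r = 0 by rewrite mulr0 add0r.
  by rewrite /g' gv hact1 subrr.
Qed.

Lemma qmon_ideal_up I s t : mult_antisymmetric q -> two_sided_ideal I ->
  (t <= s)%MM -> I (qmon q t) -> I (qmon q s).
Proof.
move=> hq idI ts It; have [_ _ _ IMr] := idI.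
have := two_sided_idealZ (qfactor q t (s - t)%MM)^-1 idI
  (IMr (qmon q (s - t)%MM) _ It).
by rewrite qmonM scalerA mulVf ?qfactor_neq0 // scale1r addmC submK.
Qed.

(** Dickson's lemma on the support of [f] gives a finite decomposition, and elimination isolates
    some [x^t] with [t <= s], of which [x^s] is a multiple. *)
Lemma Hideal_qmon I f s : infinite_set [set: k] -> mult_antisymmetric q ->
  Hideal I -> I f -> qcoef f s != 0 -> I (qmon q s).
Proof.
move=> hk hq HI If fs; have [F Fsupp FP] := dickson [set s | qcoef f s != 0].
have [F' [g [uF' F'F fE g0 F'P]]] := qseries_decomp hq FP.
have [t tF' ts] := F'P s fs.
apply: (qmon_ideal_up hq _ ts); first by case: HI.
apply: (@Hideal_eliminate I (rem t F') g) => //.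
- by rewrite /= mem_rem_uniq // inE eqxx rem_uniq.
(* The remaining exponents lie in the support of [f], which makes their cofactors invertible. *)
- move=> r; rewrite -(perm_mem (perm_to_rem tF')) => rF'.
  by apply: g0 => //; apply: Fsupp; exact: F'F.
- by rewrite -(perm_big _ (perm_to_rem tF')) -fE.
Qed.

(** * H-ideals from upward closed sets of exponents *)

Definition supported (U : set 'X_{1..n}) : set (qpseries q) :=
  [set f | forall s, qcoef f s != 0 -> U s].

Lemma supported_qmon U s : supported U (qmon q s) <-> U s.
Proof.
split=> [|Us u /=]; first by apply; rewrite /= eqxx oner_neq0.
by have [->|_] := eqVneq u s; rewrite ?eqxx.
Qed.

Lemma supported_Hideal (U : set 'X_{1..n}) :
  (forall s t, (s <= t)%MM -> U s -> U t) -> Hideal (supported U).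
Proof.
move=> Uup; split; first split.
- by move=> s /=; rewrite eqxx.
- move=> f g Uf Ug s; have [f0|fs _] := eqVneq (qcoef f s) 0; last exact: Uf.
  by rewrite qcoefD f0 add0r; exact: Ug.
- move=> a f Uf s /qcoefM_neq0[u [us _ fu]].
  exact: Uup (lem_subr _ _) (Uf _ fu).
- by move=> a f Uf s /qcoefM_neq0[u [us fu _]]; exact: Uup us (Uf _ fu).
move=> h Th f Uf s /=; rewrite mulf_eq0 negb_or => /andP[_]; exact: Uf.
Qed.

(** Finiteness of [F] makes [f] a finite combination of the [x^t], so no topological closure of [I]
    is involved. *)
Lemma ideal_cover I f (F : seq 'X_{1..n}) : mult_antisymmetric q ->
  two_sided_ideal I -> {in F, forall t, I (qmon q t)} ->
  (forall s, qcoef f s != 0 -> exists2 t, t \in F & (t <= s)%MM) -> I f.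
Proof.
move=> hq [I0 ID _ IMr] IF cover.
have [F' [g [_ F'F -> _ _]]] := qseries_decomp hq cover.
rewrite big_seq; apply: big_ind => // t tF'; apply: IMr; apply: IF; exact: F'F.
Qed.

Definition meets (w : {set 'I_n}) : set 'X_{1..n} :=
  [set s | exists2 i, i \in w & (0 < s i)%N].

Lemma lem_U i s : (U_(i) <= s)%MM = (0 < s i)%N.
Proof.
apply/mnm_lepP/idP => [/(_ i)|si j]; rewrite mnm1E ?eqxx //.
by case: eqP => [<-|].
Qed.

Lemma meets_up w s t : (s <= t)%MM -> meets w s -> meets w t.
Proof.
by move=> /mnm_lepP st [i iw si]; exists i => //; exact: leq_trans (st i).
Qed.

(** The right side is an ideal containing the generators; conversely, the finitely many [U_(i)] with
    [i] in [w] cover the support of each of its elements. *)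
Lemma JidealE w : mult_antisymmetric q -> Jideal q w = supported (meets w).
Proof.
move=> hq; apply/seteqP; split.
  apply: smallest_sub; first by case: (supported_Hideal (@meets_up w)).
  move=> _ [i iw <-]; apply/supported_qmon.
  by exists i; rewrite // -lem_U lepm_refl.
move=> f Uf J [idJ genJ].
apply: (@ideal_cover J f [seq U_(i)%MM | i <- enum w] hq idJ).
  by move=> _ /mapP[i iw ->]; apply: genJ; exists i => //=; rewrite -mem_enum.
move=> s /Uf[i iw si]; exists U_(i)%MM; last by rewrite lem_U.
by apply: map_f; rewrite mem_enum.
Qed.

(** * H-prime ideals *)

(** If [x^s] occurs in an element of [A] and [s] avoids [w], then for every [x^t] occurring in [B]
    the product [x^s x^t] is a nonzero multiple of [x^(s+t)]. Hence [s + t] meets [w], and so does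
    [t]. *)
Lemma Hprime_Jideal w : infinite_set [set: k] -> mult_antisymmetric q ->
  Hprime (Jideal q w).
Proof.
move=> hk hq; rewrite JidealE //; have HJ := supported_Hideal (@meets_up w).
split=> // [JT|A B HA HB ABJ].
  have : supported (meets w) (qmon q 0%MM) by rewrite JT.
  by move/supported_qmon => [i _]; rewrite mnm0E.
have [|/existsNP[a /not_implyP[Aa /existsNP[s /not_implyP[a_s ws]]]]] :=
  pselect (A `<=` supported (meets w)); [by left|right].
move=> b Bb t bt.
have : supported (meets w) (qmon q s * qmon q t).
  apply: ABJ; exists [:: (qmon q s, qmon q t)]; last by rewrite big_seq1.
  move=> p; rewrite inE => /eqP -> /=.
  split; first exact: Hideal_qmon HA Aa a_s.
  exact: Hideal_qmon HB Bb bt.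
rewrite qmonM => /(_ (s + t)%MM).
rewrite /= eqxx mulr1 => /(_ (qfactor_neq0 _ _ hq)).
case=> i iw; rewrite mnmDE addn_gt0 => /orP[si|ti]; last by exists i.
by case: ws; exists i.
Qed.

(** Induction on the degree of [s]: primeness splits a variable [x_i] off [x^s], leaving either
    [x_i] or a monomial of smaller degree in [I]. *)
Lemma Hprime_qmon I s : mult_antisymmetric q -> Hprime I -> I (qmon q s) ->
  exists2 i, (0 < s i)%N & I (qvar q i).
Proof.
move=> hq [[idI HI] IT Iprime]; have [d] := ubnP (mdeg s).
elim: d s => // d IH s; rewrite ltnS => sd Is.
have [s0|[i si]] : s = 0%MM \/ exists i, (0 < s i)%N.
- have [->|s0] := eqVneq s 0%MM; [by left|right].
  apply/existsP; apply: contraNT s0; rewrite negb_exists => /forallP s0.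
  by apply/eqP/mnmP => i; apply/eqP; rewrite mnm0E -leqn0 leqNgt s0.
(* Here [x^s = 1], which contradicts properness of [I]. *)
- case: IT; apply/seteqP; split=> // f _.
  by case: idI => _ _ _ IMr; rewrite -[f]mul1r; apply: IMr; rewrite s0 in Is.
pose t := (s - U_(i))%MM; have sE : s = (U_(i) + t)%MM.
  by rewrite addmC submK // lem_U.
pose up u : set 'X_{1..n} := [set v | (u <= v)%MM].
have Hup u : Hideal (supported (up u)).
  by apply: supported_Hideal => v v' vv' uv; exact: lepm_trans vv'.
have qmon_up u : supported (up u) (qmon q u).
  by apply/supported_qmon; exact: lepm_refl.
(* Primeness is applied to the series supported above [U_(i)] and above [t]; every exponent in a
   product of two such series is at least [s]. *)
have [||] := Iprime _ _ (Hup U_(i)%MM) (Hup t).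
- move=> _ [r xr ->]; have [I0 ID _ _] := idI; rewrite big_seq.
  apply: big_ind => // p /xr[p1 p2].
  apply: (@ideal_cover I _ [:: s] hq idI); first by move=> u; rewrite inE => /eqP ->.
  move=> v /qcoefM_neq0[u [uv /p1 iu /p2 tu]]; exists s; rewrite ?mem_head //.
  rewrite sE -(submK uv) addmC; apply/mnm_lepP => j; rewrite !mnmDE.
  by rewrite leq_add //; apply/mnm_lepP.
- by move=> /(_ _ (qmon_up _)) Ii; exists i.
move=> /(_ _ (qmon_up _)) It; have [||j tj Ij] := IH t => //.
  by rewrite (leq_trans _ sd) // sE mdegD mdeg1.
by exists j => //; rewrite sE mnmDE (leq_trans tj) ?leq_addl.
Qed.

(** Every monomial occurring in an element of [I] lies in [I], hence involves a variable belonging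
    to [I]. *)
Lemma Hprime_is_Jideal I : infinite_set [set: k] -> mult_antisymmetric q ->
  Hprime I -> I = Jideal q [set i | `[< I (qvar q i) >]]%SET.
Proof.
move=> hk hq HI; have [[idI hI] _ _] := HI.
apply/seteqP; split; last first.
  by apply: smallest_sub => // _ [i /= iw <-]; move: iw; rewrite inE => /asboolP.
move=> f If; rewrite JidealE // => s fs.
have [i si Ii] := Hprime_qmon hq HI (Hideal_qmon hk hq (conj idI hI) If fs).
by exists i => //; rewrite inE; apply/asboolP.
Qed.

End QSeriesTheory.

Theorem proposition4p3 (k : fieldType) (n : nat) (q : 'M[k]_n)
    (hk : infinite_set [set: k]%classic) (hn : (1 <= n)%N)
    (hq : mult_antisymmetric q) :
  range (fun w : {set 'I_n} => Jideal q w) =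
  [set I : set (qpseries q) | Hprime I].
Proof.
apply/seteqP; split=> [_ [w _ <-]|I HI]; first exact: Hprime_Jideal.
by rewrite [I](Hprime_is_Jideal hk hq HI); exists [set i | `[< I (qvar q i) >]]%SET.
Qed.
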